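(* Let $0<p<q$ be real numbers. Then there exist real-valued maps $\psi_{j,k}:\mathbb{R}\to\mathbb{R}$, $(j,k)\in\mathbb{Z}\times\mathbb{Z}$, and positive constants $A_{p,q}, B_{p,q}$ such that $$A_{p,q}\,|x-y|^p\le \sum_{k\in\mathbb{Z}}\sum_{j\in\mathbb{Z}}|\psi_{j,k}(x)-\psi_{j,k}(y)|^q\le B_{p,q}\,|x-y|^p\qquad\text{for all } x,y\in\mathbb{R}.$$ *)

(* Defs.v *)
From HB Require Import structures.
From mathcomp Require Export all_boot all_order all_algebra.
From mathcomp Require Export all_classical all_reals all_analysis.

(* Main.v *)
Require Import Defs.
From mathcomp Require Import all_boot all_order all_algebra.
From mathcomp Require Import all_classical all_reals all_analysis.
From mathcomp Require Import ring lra zify.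
Import Order.TTheory GRing.Theory Num.Theory.
Import numFieldNormedType.Exports.
Local Open Scope classical_set_scope.
Local Open Scope ring_scope.

Set Implicit Arguments.
Unset Strict Implicit.
Unset Printing Implicit Defensive.

(** For each dyadic scale [2 ^ k], wrap the line around a circle of length
    [2 * 2 ^ k] and blow that circle up to radius [2 ^ (k p / q)]. The two
    coordinates of this curve are the functions of level [k], so two nonzero
    indices [j] suffice at every level.

    Let [|x - y| = 2 ^ u]. On the unit circle the two images are separated by
    an arc [pi * 2 ^ (u - k)], and the level [k] sum is [2 ^ (k p)] times the
    [q]-th powers of the differences of the cosines and of the sines.

    Upper bound: these differences are at most [pi * min (1, 2 ^ (u - k))],
    because the trigonometric functions are bounded and 1-Lipschitz. Relative to
    the target [2 ^ (u p) = |x - y| ^ p], a coarse level [k > u] therefore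
    contributes [2 ^ (- (q - p) (k - u))], and a fine level [k <= u] contributes
    [2 ^ (- p (u - k))], up to a constant ([scaled_term_le]). As [p] and [q - p]
    are positive, the sum over all levels is dominated by a two-sided geometric
    series whose sum is bounded independently of [u] ([esum_exp_decay_le]).

    Lower bound: a single level is enough. The integer [k] in [(u, u + 1]] makes
    the arc lie in [[pi / 2, pi]]; then the chord has length at least [sqrt 2],
    so one of its two coordinates is at least 1 ([circle_chord_ge1]), and the
    level contributes at least [2 ^ (k p) >= |x - y| ^ p]. *)

(** * Trigonometric estimates *)

Lemma norm_cosB_le (R : realType) (x y : R) : `|cos x - cos y| <= `|x - y|.
Proof.
wlog xy : x y / x <= y.
  by move=> H; have [/H//|/ltW/H] := leP x y; rewrite distrC [leRHS]distrC.
have cts : {within `[x, y], continuous (@cos R)}.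
  by apply: continuous_subspaceT; exact: continuous_cos.
have [c _] := MVT_segment xy (fun t _ => is_derive_cos t) cts.
rewrite distrC => ->; rewrite normrM normrN [`|y - x|]distrC ler_piMl//.
by rewrite ler_norml sin_geN1 sin_le1.
Qed.

Lemma norm_sinB_le (R : realType) (x y : R) : `|sin x - sin y| <= `|x - y|.
Proof.
rewrite -!cosBpihalf (le_trans (norm_cosB_le _ _))//.
by rewrite opprB addrA subrK.
Qed.

(** An arc between a quarter and a half circle has a chord of squared length
    [2 - 2 cos (x - y) >= 2]; its two coordinates cannot both be below 1. *)
Lemma circle_chord_ge1 (R : realType) (x y : R) :
  pi / 2 <= `|x - y| <= pi ->
  (1 <= `|cos x - cos y|) || (1 <= `|sin x - sin y|).
Proof.
move=> /andP[le1 le2].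
(* A shift by pi moves the arc into [- pi / 2, 0], where cosine is nonnegative. *)
have cosD_le0 : cos (x - y) <= 0.
  have -> : cos (x - y) = - cos (`|x - y| - pi).
    by rewrite [in RHS]cosB cospi sinpi mulrN1 mulr0 addr0 opprK cos_norm.
  rewrite oppr_le0 cos_ge0_pihalf//; lra.
have eqsum : (cos x - cos y) ^+ 2 + (sin x - sin y) ^+ 2 = 2 - 2 * cos (x - y).
  rewrite cosB; have := cos2Dsin2 x; have := cos2Dsin2 y; lra.
apply/negPn; rewrite negb_or -!ltNge; apply/negP => /andP[c1 s1].
have lt1 (z : R) : `|z| < 1 -> z ^+ 2 < 1.
  by move=> z1; rewrite -real_normK ?num_real// expr_lt1.
have := lt1 _ c1; have := lt1 _ s1; lra.
Qed.

(** The bound 2 is weakened to [pi] so that it shares its constant with the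
    Lipschitz bound [pi * 2 ^ (u - k)] on the same differences. *)
Lemma norm_trigB_le_pi (R : realType) (a b : R) :
  -1 <= a <= 1 -> -1 <= b <= 1 -> `|a - b| <= pi.
Proof.
by move=> a1 b1; rewrite (le_trans _ (pi_ge2 R))// ler_norml; lra.
Qed.

(** * Geometric series over the integers *)

Lemma esum_geometric_le (R : realType) (a r : R) : 0 <= a -> 0 < r < 1 ->
  (\esum_(n in [set: nat]) (a * r ^+ n)%:E <= (a / (1 - r))%:E)%E.
Proof.
move=> a0 /andP[r0 r1].
have ge0 n : (0 <= (a * r ^+ n)%:E)%E.
  by rewrite lee_fin mulr_ge0// exprn_ge0// ltW.
rewrite -nneseries_esumT//.
apply: lime_le; first exact: is_cvg_nneseries.
near=> n.
by rewrite sumEFin lee_fin geometric_le_lim// gtr0_norm.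
Unshelve. all: by end_near. Qed.

Lemma esum_bilateral_geometric_le (R : realType) (a r : R) (m : int) :
  0 <= a -> 0 < r < 1 ->
  (\esum_(k in [set: int]) (a * r ^+ `|k - m|%N)%:E <=
    (2 * (a / (1 - r)))%:E)%E.
Proof.
move=> a0 r01; have /andP[r0 r1] := r01.
have ge0 n : 0 <= a * r ^+ n by rewrite mulr_ge0// exprn_ge0// ltW.
rewrite (esumID [set k | m <= k]); last by move=> k _; rewrite lee_fin.
rewrite !setTI mulr_natl mulr2n EFinD.
have -> : [set k | m <= k] = [set m + n%:Z | n in [set: nat]].
  apply/seteqP; split => [k /= mk|_ [n _ <-]]; last by rewrite /=; lia.
  by exists `|k - m|%N => //; lia.
have -> : ~` [set m + n%:Z | n in [set: nat]] =
          [set m - n.+1%:Z | n in [set: nat]].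
  apply/seteqP; split => [k /= mk|_ [n _ <-]/=]; last by move=> [n' _]; lia.
  have km : k < m.
    by rewrite ltNge; apply/negP => km; apply: mk; exists `|k - m|%N => //; lia.
  by exists `|m - k|%N.-1 => //; lia.
rewrite !esum_image; last 2 first.
- by move=> ? ? _ _ /=; lia.
- by move=> ? ? _ _ /=; lia.
apply: leeD; apply: le_trans (esum_geometric_le a0 r01); apply: le_esum => n _.
  by rewrite (_ : `|_|%N = n)//; lia.
rewrite (_ : `|_|%N = n.+1); last lia.
by rewrite lee_fin exprS mulrCA ler_piMl// ltW.
Qed.

Lemma half_powR_itv (R : realType) (e : R) : 0 < e -> 0 < (2 : R) `^ (- e) < 1.
Proof.
move=> e0; rewrite powR_gt0//= powRN invf_lt1 ?powR_gt0//.
rewrite -[ltLHS](powRr0 2) /powR pnatr_eq0/= ltr_expR.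
by rewrite ltr_pM2r// ln_gt0// ltr1n.
Qed.

(** The centre [u] is any real number and the bound does not depend on it: this
    is what makes the estimate uniform in the distance [2 ^ u]. Replacing [u] by
    its integer part moves each exponent by at most [e], whence the factor
    [2 ^ e]. *)
Lemma esum_exp_decay_le (R : realType) (a e u : R) : 0 <= a -> 0 < e ->
  (\esum_(k in [set: int]) (a * 2 `^ (- (e * `|k%:~R - u|)))%:E <=
    (2 * (a * 2 `^ e / (1 - 2 `^ (- e))))%:E)%E.
Proof.
move=> a0 e0.
have r01 := half_powR_itv e0.
pose m := Num.floor u.
have ae0 : 0 <= a * 2 `^ e by rewrite mulr_ge0// powR_ge0.
apply: le_trans (esum_bilateral_geometric_le m ae0 r01).
apply: le_esum => k _; rewrite lee_fin -mulrA ler_wpM2l//.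
rewrite -powR_mulrn ?powR_ge0// -powRrM -powRD ?pnatr_eq0 ?implybT//.
apply: ler_powR; first by rewrite ler1n.
have le_km : (`|k - m|%N)%:R <= `|k%:~R - u| + 1.
  rewrite -[X in X <= _]/((`|k - m|%N%:Z)%:~R) abszE intr_norm intrB.
  have := floor_le u; have := floorD1_gt u; rewrite intrD -/m.
  move: (k%:~R : R) (m%:~R : R) => K M ? ?.
  have -> : K - M = (K - u) + (u - M) by ring.
  by rewrite (le_trans (ler_normD _ _))// lerD2l ger0_norm; lra.
by move: le_km; move: (_%:R) `|_| => N D; nra.
Qed.

(** * Circles at all dyadic scales *)

Lemma esum_int_two_terms (R : realType) (F : int -> \bar R) :
  (forall j, 0 <= F j)%E -> (forall j, j != 0 -> j != 1 -> F j = 0%E) ->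
  \esum_(j in [set: int]) F j = (F 0%R + F 1%R)%E.
Proof.
move=> F0 Fsupp.
have -> : \esum_(j in [set: int]) F j = \esum_(j in [set 0%R; 1%R]) F j.
  rewrite [RHS]esum_mkcond; apply: eq_esum => j _; case: ifPn => //.
  by rewrite notin_setE => /not_orP[/eqP j0 /eqP j1]; exact: Fsupp.
by rewrite esum_fset// fsbigU0 ?fsbig_set1//; move=> j [/= -> ].
Qed.

(** Level [k] parametrizes a circle of radius [2 ^ (k p / q)] with period
    [2 * 2 ^ k]; together the levels form the analogue of the classical
    snowflake embeddings of the line as a helix in a Hilbert space. *)
Definition helix (R : realType) (p q : R) (j k : int) (x : R) : R :=
  2 `^ (k%:~R * p / q) *
  if j == 0 then cos (pi * 2 `^ (- k%:~R) * x)
  else if j == 1 then sin (pi * 2 `^ (- k%:~R) * x) else 0.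

Lemma norm_phaseB (R : realType) (u x y : R) (k : int) : `|x - y| = 2 `^ u ->
  `|pi * 2 `^ (- k%:~R) * x - pi * 2 `^ (- k%:~R) * y| = pi * 2 `^ (u - k%:~R).
Proof.
move=> xy; rewrite -mulrBr normrM xy ger0_norm ?mulr_ge0 ?pi_ge0 ?powR_ge0//.
by rewrite -mulrA -powRD ?pnatr_eq0 ?implybT// addrC.
Qed.

Lemma powR_scaleB (R : realType) (p q : R) (k : int) (a b : R) : 0 < q ->
  `|2 `^ (k%:~R * p / q) * a - 2 `^ (k%:~R * p / q) * b| `^ q =
  2 `^ (k%:~R * p) * `|a - b| `^ q.
Proof.
move=> q0; rewrite -mulrBr normrM powRM// ger0_norm ?powR_ge0// -powRrM divfK//.
by rewrite gt_eqF.
Qed.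

Lemma esum_helix (R : realType) (p q x y : R) (k : int) : 0 < q ->
  \esum_(j in [set: int]) (`|helix p q j k x - helix p q j k y| `^ q)%:E =
  (2 `^ (k%:~R * p) *
    (`|cos (pi * 2 `^ (- k%:~R) * x) - cos (pi * 2 `^ (- k%:~R) * y)| `^ q +
     `|sin (pi * 2 `^ (- k%:~R) * x) - sin (pi * 2 `^ (- k%:~R) * y)| `^ q))%:E.
Proof.
move=> q0; rewrite esum_int_two_terms.
- by rewrite /helix/= !powR_scaleB// -EFinD mulrDr.
- by move=> j; rewrite lee_fin powR_ge0.
- move=> j /negPf j0 /negPf j1; rewrite /helix j0 j1 subrr normr0 powR0//.
  by rewrite gt_eqF.
Qed.

(** The contribution of level [s] to a pair of points at distance [2 ^ u]. On
    exponents, the claim is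
    [s p + q min (0, u - s) <= u p - e |s - u|]: fine levels [s <= u] use
    [e <= p], coarse levels [s > u] use [e <= q - p]. *)
Lemma scaled_term_le (R : realType) (p q e u s w : R) :
  0 < q -> e <= p -> e <= q - p -> 0 <= w <= pi -> w <= pi * 2 `^ (u - s) ->
  2 `^ (s * p) * w `^ q <= pi `^ q * 2 `^ (u * p) * 2 `^ (- (e * `|s - u|)).
Proof.
move=> q0 ep eqp /andP[w0 wpi] wu.
have wmin : w <= pi * 2 `^ Num.min 0 (u - s).
  by rewrite minEle; case: ifP; rewrite ?powRr0 ?mulr1.
have : w `^ q <= (pi * 2 `^ Num.min 0 (u - s)) `^ q.
  by rewrite ge0_ler_powR// ?ltW// nnegrE// mulr_ge0 ?pi_ge0 ?powR_ge0.
rewrite powRM ?pi_ge0 ?powR_ge0// -powRrM => wq.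
rewrite (le_trans (ler_wpM2l (powR_ge0 _ _) wq))//.
rewrite mulrCA -[leRHS]mulrA ler_wpM2l ?powR_ge0//.
rewrite -!powRD ?pnatr_eq0 ?implybT//; apply: ler_powR; first by rewrite ler1n.
by rewrite minEle; case: ifPn => su; case: ger0P => ?; nra.
Qed.

Theorem theorem3p4 (R : realType) (p q : R) (hp : 0 < p) (hpq : p < q) :
  exists (psi : int -> int -> R -> R) (A B : R),
    [/\ 0 < A, 0 < B &
      forall x y : R,
        ((A * `|x - y| `^ p)%:E <=
          \esum_(k in [set: int]) \esum_(j in [set: int])
            (`|psi j k x - psi j k y| `^ q)%:E <=
          (B * `|x - y| `^ p)%:E)%E].
Proof.
have q0 : 0 < q by rewrite (lt_trans hp).
pose e := Num.min p (q - p).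
have e0 : 0 < e by rewrite lt_min hp subr_gt0.
have [ep eqp] : e <= p /\ e <= q - p by split; rewrite ge_min lexx ?orbT.
have r1 : 0 < 1 - (2 : R) `^ (- e).
  by rewrite subr_gt0; have /andP[] := half_powR_itv e0.
pose B : R := 2 * (2 * pi `^ q * 2 `^ e / (1 - 2 `^ (- e))).
exists (helix p q), 1, B; split => //.
  by rewrite /B !mulr_gt0// ?invr_gt0// powR_gt0// pi_gt0.
move=> x y; have [->|neq_xy] := eqVneq x y.
  rewrite subrr normr0 powR0 ?gt_eqF// !mulr0 esum1 ?lexx// => k _.
  by apply: esum1 => j _; rewrite subrr normr0 powR0 ?gt_eqF.
have [u xyE] : exists u, `|x - y| = 2 `^ u.
  exists (ln `|x - y| / ln 2); rewrite /powR pnatr_eq0/= divfK.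
    by rewrite lnK// posrE normr_gt0 subr_eq0.
  by rewrite gt_eqF// ln_gt0// ltr1n.
under eq_esum do rewrite esum_helix//.
rewrite xyE mul1r -powRrM; apply/andP; split.
  (* This level places the arc pi * 2 ^ (u - k) between pi / 2 and pi. *)
  pose k := Num.floor u + 1.
  apply: esum_ge; exists [set k]; first by split => //; exact: finite_set1.
  rewrite fsbig_set1 lee_fin.
  have uk : u <= k%:~R by rewrite ltW// floorD1_gt.
  have ku : k%:~R <= u + 1 by rewrite intrD lerD2r floor_le.
  have le2 s t : s <= t -> (2 : R) `^ s <= 2 `^ t.
    by apply: ler_powR; rewrite ler1n.
  apply: (@le_trans _ _ (2 `^ (k%:~R * p))).
    by rewrite le2// ler_wpM2r// ltW.
  rewrite ler_peMr ?powR_ge0//.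
  have ge1 z : 1 <= z -> 1 <= z `^ q.
    by move=> z1; rewrite -[leLHS](powRr0 z) ler_powR// ltW.
  have /orP[/ge1 c1|/ge1 s1] :
      (1 <= `|cos (pi * 2 `^ (- k%:~R) * x) - cos (pi * 2 `^ (- k%:~R) * y)|) ||
      (1 <= `|sin (pi * 2 `^ (- k%:~R) * x) - sin (pi * 2 `^ (- k%:~R) * y)|).
  - apply: circle_chord_ge1; rewrite (norm_phaseB _ xyE); apply/andP; split.
      rewrite ler_pM2l ?pi_gt0// -[leLHS]powR_inv1 ?ler0n//.
      by rewrite le2//; lra.
    rewrite ler_piMr ?pi_ge0// -[leRHS](powRr0 2) le2//; lra.
  - by rewrite (le_trans c1)// lerDl powR_ge0.
  - by rewrite (le_trans s1)// lerDr powR_ge0.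
have C0 : 0 <= 2 * pi `^ q * 2 `^ (u * p) by rewrite !mulr_ge0 ?powR_ge0.
rewrite (_ : B * _ =
  2 * (2 * pi `^ q * 2 `^ (u * p) * 2 `^ e / (1 - 2 `^ (- e)))).
  apply: le_trans (esum_exp_decay_le u C0 e0); apply: le_esum => k _.
  rewrite lee_fin mulrDr -!mulrA mulr_natl mulr2n !mulrA.
  have phase := norm_phaseB k xyE.
  apply: lerD; apply: scaled_term_le => //; rewrite ?normr_ge0 -?phase.
  - by rewrite norm_trigB_le_pi// ?cos_geN1 cos_le1.
  - exact: norm_cosB_le.
  - by rewrite norm_trigB_le_pi// ?sin_geN1 sin_le1.
  - exact: norm_sinB_le.
by rewrite /B; ring.
Qed.
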